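(* Let $N,n$ be positive integers, let $\Gamma\subseteq\mathbb{R}^N$ be a convex cone, let $F:\mathbb{R}^N\rightsquigarrow\mathbb{R}^n$ be a set-valued map, let $(\bar\gamma,\bar y)\in\mathbb{R}^N\times\mathbb{R}^n$, and let $\Lambda\subset \mathrm{Lin}(\mathbb{R}^N,\mathbb{R}^n)$ be a Quasi Differential Quotient (QDQ) of $F$ at $(\bar\gamma,\bar y)$ in the direction of $\Gamma$, with modulus $\rho$. Assume that $\Lambda$ is surjective, i.e. $L\cdot\Gamma=\mathbb{R}^n$ for every $L\in\Lambda$. Then: (i) there are positive constants $\alpha,\beta$ such that $$\bar y+\big(B_a\setminus\{0\}\big)\subset F\big(\bar\gamma+B_{a\beta}\cap\Gamma\big)\qquad\text{for all } a\in\,]0,\alpha];$$ (ii) there exists $\check\delta>0$ such that, for every $\delta\in\,]0,\check\delta]$ and every continuous map $(L_\delta,h_\delta):\bar\gamma+B_\delta\cap\Gamma\to \mathrm{Lin}(\mathbb{R}^N,\mathbb{R}^n)\times\mathbb{R}^n$ as in the definition of QDQ, there exists $\gamma_\delta\in\bar\gamma+\Gamma\cap B_\delta$ such that $$\bar y=\bar y+L_\delta(\gamma_\delta)\cdot(\gamma_\delta-\bar\gamma)+h_\delta(\gamma_\delta)\ \in F(\gamma_\delta).$$ In particular, by possibly reducing the size of $\alpha$, one has $$\bar y+B_a\subset F\big(\bar\gamma+B_{a\beta}\cap\Gamma\big)\qquad\text{for all } a\in\,]0,\alpha].$$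
   Context: $B_r$ denotes the closed ball of radius $r$ centered at $0$ (in the relevant Euclidean space). A cone is a subset $K$ of a real linear space with $\alpha k\in K$ for all $\alpha\ge 0$, $k\in K$. $\mathrm{Lin}(\mathbb{R}^N,\mathbb{R}^n)$ is the space of linear maps with operator norm $|\cdot|$; $L\cdot v$ is the image of $v$ under $L$, and $L\cdot\Gamma=\{L\cdot\gamma:\gamma\in\Gamma\}$. For a set-valued map $F$ and a set $A$, $F(A)=\bigcup_{\gamma\in A}F(\gamma)$. A modulus is a nondecreasing function $\rho:[0,+\infty[\to[0,+\infty[$ with $\lim_{s\to0^+}\rho(s)=\rho(0)=0$. Definition (QDQ). Let $F:\mathbb{R}^N\rightsquigarrow\mathbb{R}^n$ be a set-valued map, $(\bar\gamma,\bar y)\in\mathbb{R}^N\times\mathbb{R}^n$, $\Lambda\subset \mathrm{Lin}(\mathbb{R}^N,\mathbb{R}^n)$ a compact set, and $\Gamma\subset\mathbb{R}^N$ any subset. $\Lambda$ is a Quasi Differential Quotient (QDQ) of $F$ at $(\bar\gamma,\bar y)$ in the direction of $\Gamma$ if there exists a modulus $\rho$ such that for every $\delta>0$ there is a continuous map $(L_\delta,h_\delta):\bar\gamma+B_\delta\cap\Gamma\to \mathrm{Lin}(\mathbb{R}^N,\mathbb{R}^n)\times\mathbb{R}^n$ with $$\min_{L'\in\Lambda}|L_\delta(\gamma)-L'|\le\rho(\delta),\qquad |h_\delta(\gamma)|\le\delta\rho(\delta),\qquad \bar y+L_\delta(\gamma)\cdot(\gamma-\bar\gamma)+h_\delta(\gamma)\in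 F(\gamma)$$ for all $\gamma\in\bar\gamma+B_\delta\cap\Gamma$. The maps $(L_\delta,h_\delta)$ ''as in the definition of QDQ'' are those satisfying these conditions for the given modulus $\rho$. *)

(* Defs.v *)
From HB Require Import structures.
From mathcomp Require Import all_boot all_order all_algebra.
From mathcomp Require Import all_classical all_reals all_analysis.
Set Implicit Arguments.
Unset Strict Implicit.
Unset Printing Implicit Defensive.
Import Order.TTheory GRing.Theory Num.Theory.
Import numFieldNormedType.Exports.
Local Open Scope classical_set_scope.
Local Open Scope ring_scope.

(* R^N is 'cV[R]_N and Lin(R^N, R^n) is 'M[R]_(n, N), a linear map L acting by
   v |-> L *m v.  The library norm `|_| on matrices is the max norm, so the
   Euclidean and operator norms are defined here; the library topology of
   matrices (entrywise convergence) is the one they induce. *)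

Definition enorm (R : realType) (n : nat) (v : 'cV[R]_n) : R :=
  Num.sqrt (\sum_(i < n) v i 0 ^+ 2).

Definition opnorm (R : realType) (n N : nat) (L : 'M[R]_(n, N)) : R :=
  sup [set enorm (L *m v) | v in [set v : 'cV[R]_N | enorm v <= 1]].

Definition cball (R : realType) (n : nat) (r : R) : set 'cV[R]_n :=
  [set v | enorm v <= r].
Arguments cball {R n} r.

Definition translate (R : realType) (n : nat) (c : 'cV[R]_n)
    (A : set 'cV[R]_n) : set 'cV[R]_n :=
  [set c + v | v in A].

Definition cone (R : realType) (n : nat) (K : set 'cV[R]_n) : Prop :=
  forall (a : R) (k : 'cV[R]_n), 0 <= a -> K k -> K (a *: k).

Definition svimage (R : realType) (N n : nat) (F : 'cV[R]_N -> set 'cV[R]_n)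
    (A : set 'cV[R]_N) : set 'cV[R]_n :=
  \bigcup_(g in A) F g.

Definition is_minimum (R : realType) (A : set R) (m : R) : Prop :=
  A m /\ lbound A m.

(* Only the values of [rho] on [0, +oo[ matter. *)
Definition modulus (R : realType) (rho : R -> R) : Prop :=
  [/\ forall s, 0 <= s -> 0 <= rho s,
      forall s t, 0 <= s -> s <= t -> rho s <= rho t,
      rho 0 = 0
    & rho s @[s --> 0^'+] --> 0].

(* The map (L_delta, h_delta) is given by total functions L and h, of which only
   the restrictions to gbar + (B_delta `&` Gamma) are constrained. *)
Definition qdq_map (R : realType) (N n : nat) (F : 'cV[R]_N -> set 'cV[R]_n)
    (gbar : 'cV[R]_N) (ybar : 'cV[R]_n) (Lambda : set 'M[R]_(n, N))
    (Gamma : set 'cV[R]_N) (rho : R -> R) (delta : R)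
    (L : 'cV[R]_N -> 'M[R]_(n, N)) (h : 'cV[R]_N -> 'cV[R]_n) : Prop :=
  let D := translate gbar (cball delta `&` Gamma) in
  {within D, continuous (fun g => (L g, h g))} /\
  forall g, D g ->
    [/\ exists2 m, is_minimum [set opnorm (L g - L') | L' in Lambda] m
                 & m <= rho delta,
        enorm (h g) <= delta * rho delta
      & F g (ybar + L g *m (g - gbar) + h g)].

(* [Lambda] is required to be nonempty because the minimum over [Lambda] is
   meaningful only then; when [Gamma] is empty no other clause forces it. *)
Definition is_QDQ_with (R : realType) (N n : nat)
    (F : 'cV[R]_N -> set 'cV[R]_n) (gbar : 'cV[R]_N) (ybar : 'cV[R]_n)
    (Lambda : set 'M[R]_(n, N)) (Gamma : set 'cV[R]_N) (rho : R -> R) : Prop :=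
  [/\ compact Lambda, Lambda !=set0, modulus rho
    & forall delta, 0 < delta ->
        exists L h, qdq_map F gbar ybar Lambda Gamma rho delta L h].

(* Main.v *)
(* Pick finitely many matrices L_j in Lambda, preimages in Gamma under L_j of the
   vectors +- e_i, and a partition of unity (theta_j) near Lambda.  For M close to
   Lambda the map w |-> sum_j theta_j(M) sum_i |w_i| g_(j,i,sign w_i) is then, up to an
   error |w|/2, a right inverse of M, it depends continuously on (M, w), and it
   takes values in the convex cone Gamma.  Substituting it into
   L(gbar + v) v + h(gbar + v) = y turns the equation into a fixed point problem
   for (coefficients of v, w) on a cube, whatever the size of Gamma and without
   any closedness of it.  Brouwer's theorem gives a solution v with |v| <= delta
   as soon as |y| <= delta / (4 C) and rho(delta) is small; this covers y = 0.
   Brouwer's theorem is obtained from Scarf's theorem on finite sets with several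
   linear orders, which needs no triangulation. *)
From mathcomp Require Import all_boot zify.
Set Implicit Arguments.
Unset Strict Implicit.
Unset Printing Implicit Defensive.

(** * Scarf's theorem *)

(** Losing exactly one point, [f] has a single fibre with two elements and is injective elsewhere;
    the set counted is that fibre. Both parity counts below, rooms at a door and doors of a room,
    reduce to this. *)
Lemma card_collisions (A B : finType) (f : A -> B) (D : {set A}) :
  #|D| = #|f @: D|.+1 -> #|[set x in D | f x \in f @: (D :\ x)]| = 2.
Proof.
move=> cD.
have [x1 [x2 [x1D x2D x12 f12]]] :
    exists x1 x2, [/\ x1 \in D, x2 \in D, x1 != x2 & f x1 = f x2].
  have /dinjectivePn[x xD [y /andP[/= yx yD] fxy]] : ~~ dinjectiveb f D.
    apply/negP => /dinjectiveP /card_in_imset e.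
    by move: cD; rewrite e => /eqP; rewrite eqn_leq ltnn andbF.
  by exists x, y; rewrite eq_sym.
have inj (u v : A) : u \in D -> v \in D -> u != v -> f u = f v ->
    {in D :\ u &, injective f}.
  move=> uD vD uv fuv; apply/imset_injP/eqP.
  have -> : f @: (D :\ u) = f @: D.
    apply/eqP; rewrite eqEsubset imsetS ?subD1set //=.
    apply/subsetP => _ /imsetP[x xD ->].
    have [->|xu] := eqVneq x u; first by rewrite fuv imset_f // !inE eq_sym uv.
    by rewrite imset_f // !inE xu.
  by have := cardsD1 u D; rewrite uD cD => -[->].
have <- : #|[set x1; x2]| = 2 by rewrite cards2 x12.
apply: eq_card => x; rewrite !inE; apply/idP/idP; last first.
  case/orP => /eqP ->; first by rewrite x1D f12 imset_f // !inE eq_sym x12.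
  by rewrite x2D -f12 imset_f // !inE x12.
case/andP => xD /imsetP[y]; rewrite !inE => /andP[yx yD] fxy.
apply/negPn/negP; rewrite negb_or => /andP[xx1 xx2].
have [yx1|yx1] := eqVneq y x1.
  move: fxy; rewrite {y}yx1 in yx yD * => fxy.
  have := inj x2 x1 x2D x1D; rewrite eq_sym x12 => /(_ isT (esym f12) x x1).
  by rewrite !inE xx2 xD yD x12 => /(_ isT isT fxy) e; rewrite e eqxx in xx1.
have := inj x1 x2 x1D x2D x12 f12 x y.
by rewrite !inE xx1 xD yD yx1 => /(_ isT isT fxy) e; rewrite e eqxx in yx.
Qed.

(* Each point [x] is below all of [S] for some order: no point exceeds [S] in all
   orders.  With |I| orders these are the rooms (|S| = |I|) and doors
   (|S| = |I| - 1) of Scarf's path-following argument; a door lies in at most two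
   rooms. *)
Definition dominant (I E : finType) (r : I -> E -> nat) (S : {set E}) :=
  [forall x, exists i, forall y in S, r i x <= r i y].

Section Dominant.
Variables (I E : finType) (r : I -> E -> nat).
Hypothesis r_inj : forall i, injective (r i).

Lemma dominantP (S : {set E}) :
  reflect (forall x, exists i, forall y, y \in S -> r i x <= r i y) (dominant r S).
Proof.
apply: (iffP forallP) => h x.
  by have /existsP[i /forall_inP hi] := h x; exists i.
by have [i hi] := h x; apply/existsP; exists i; apply/forall_inP.
Qed.

Lemma dominantS (S S' : {set E}) : S \subset S' -> dominant r S' -> dominant r S.
Proof.
move=> /subsetP sS /dominantP h; apply/dominantP => x.
by have [i hi] := h x; exists i => y /sS; exact: hi.
Qed.

Definition min_at (S : {set E}) (m : I -> E) :=
  forall i, m i \in S /\ forall y, y \in S -> r i (m i) <= r i y.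

Lemma min_at_exists (S : {set E}) : S != set0 -> exists m, min_at S m.
Proof.
case/set0Pn => y0 y0S.
exists (fun i => [arg min_(y < y0 in S) r i y]) => i.
by case: arg_minnP => // y yS ymin; split.
Qed.

Lemma min_at_uniq (S : {set E}) m i y : min_at S m -> y \in S ->
  (forall z, z \in S -> r i y <= r i z) -> y = m i.
Proof.
move=> mS yS ymin; apply: (@r_inj i); apply/eqP.
by have [mi mi2] := mS i; rewrite eqn_leq ymin // mi2.
Qed.

Lemma min_at_onto (S : {set E}) m :
  min_at S m -> dominant r S -> m @: setT = S.
Proof.
move=> mS /dominantP dS; apply/setP => y; apply/imsetP/idP => [[i _ ->]|yS].
  by case: (mS i).
by have [i hi] := dS y; exists i => //; apply: min_at_uniq.
Qed.

(* If dropping the order [i] leaves every point of [S] minimal for some other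
   order, then [S] extends to exactly one dominant set whose new point is
   [i]-minimal, namely by the [i]-largest point of
   {x | r j x > r j (m j) for all j != i}. *)
Lemma door_rooms (S : {set E}) m :
    min_at S m -> dominant r S -> #|I| = #|S|.+1 ->
    (forall i, exists x, forall j, j != i -> r j (m j) < r j x) ->
  #|[set x | (x \notin S) && dominant r (x |: S)]| = 2.
Proof.
move=> mS dS cI hM; have ontoS := min_at_onto mS dS.
(* The orders sharing their minimum with another order: [m] maps [I] onto [S], which has one element
   less, so there are two of them. *)
pose free := [set i in setT | m i \in m @: (setT :\ i)].
have cfree : #|free| = 2 by apply: card_collisions; rewrite ontoS cardsT.
pose M i := [pred x | [forall j, (j != i) ==> (r j (m j) < r j x)]].
have [x0 x0M] : exists x0 : I -> E, forall i, M i (x0 i).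
  have hx i : exists x, M i x.
    have [x hx] := hM i; exists x; apply/forallP => j; apply/implyP; exact: hx.
  by exists (fun i => xchoose (hx i)) => i; exact: (xchooseP (hx i)).
pose g i := [arg max_(x > x0 i | M i x) r i x].
have gM i : M i (g i) by rewrite /g; case: arg_maxnP => //; exact: x0M.
have gmax i x : M i x -> r i x <= r i (g i).
  by rewrite /g; case: arg_maxnP => [|y _ h /h //]; exact: x0M.
have gMlt i j : j != i -> r j (m j) < r j (g i).
  by move=> ji; have /forallP/(_ j)/implyP/(_ ji) := gM i.
have freeP i : i \in free -> forall y, y \in S -> exists2 j, j != i & y = m j.
  rewrite !inE => /imsetP[j0]; rewrite !inE andbT => j0i mij0 y.
  rewrite -ontoS => /imsetP[j _ ->].
  by have [->|ji] := eqVneq j i; [exists j0|exists j].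
have gnS i : i \in free -> g i \notin S.
  move=> fi; apply/negP => /(freeP i fi)[j ji e].
  by have := gMlt i j ji; rewrite e ltnn.
(* Every order but [i] puts [g i] above its minimum of [S], so [i] alone can witness dominance at
   [g i]. *)
have gmin i : i \in free -> forall y, y \in S -> r i (g i) < r i y.
  move=> fi y yS; have [k hk] := dominantP _ dS (g i).
  have [e|ki] := eqVneq k i; last first.
    by have := hk (m k) (mS k).1; rewrite leqNgt gMlt.
  rewrite {k}e in hk; rewrite ltn_neqAle hk // andbT.
  by apply: contraNneq (gnS i fi) => /r_inj ->.
have g_inj : {in free &, injective g}.
  move=> i j fi fj gij; apply/eqP/negPn/negP => ij.
  have := gMlt j i ij; rewrite -gij ltnNge => /negP; apply.
  by apply/ltnW/gmin => //; case: (mS i).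
rewrite -cfree -(card_in_imset g_inj); apply: eq_card => x.
rewrite !inE; apply/idP/imsetP => [/andP[xS dR]|[i fi ->]]; last first.
  rewrite gnS //=; apply/dominantP => z.
  have [Mz|] := boolP (M i z).
    exists i => y; rewrite !inE => /orP[/eqP->|yS]; first exact: gmax.
    by rewrite (leq_trans (gmax _ _ Mz)) // ltnW // gmin.
  rewrite negb_forall => /existsP[j]; rewrite negb_imply -leqNgt => /andP[ji hz].
  exists j => y; rewrite !inE => /orP[/eqP->|yS].
    by rewrite (leq_trans hz) // ltnW // gMlt.
  by rewrite (leq_trans hz) // (mS j).2.
have [m' mR] : exists m', min_at (x |: S) m'.
  by apply: min_at_exists; apply/set0Pn; exists x; rewrite !inE eqxx.
have ontoR := min_at_onto mR dR.
(* The room has as many points as there are orders, so each point is minimal for exactly one order;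
   that of [x] is the [i] sought. *)
have inj' : injective m'.
  apply/injectiveP; apply/dinjectiveP.
  have : #|m' @: setT| == #|[set: I]| by rewrite ontoR cardsT cardsU1 xS cI.
  move=> /imset_injP h u v _ _; apply: h; exact: in_setT.
have [i xi] : exists i, x = m' i.
  by have : x \in m' @: setT by [rewrite ontoR setU11]; case/imsetP => i; exists i.
have m'E j : j != i -> m' j = m j.
  move=> ji; have [m'R m'min] := mR j.
  apply: min_at_uniq mS _ _ => [|z zS]; last by rewrite m'min // !inE zS orbT.
  by move: m'R; rewrite !inE xi (inj_eq inj') (negbTE ji).
have fi : i \in free.
  rewrite !inE /=; have miS := (mS i).1.
  have : m i \in m' @: setT by rewrite ontoR !inE miS orbT.
  case/imsetP => j _ e; have [ji|ji] := eqVneq j i.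
    by rewrite e ji -xi (negbTE xS) in miS.
  by rewrite e m'E // imset_f // !inE ji.
exists i => //; apply: (@r_inj i); apply/eqP; rewrite eqn_leq gmax /=; last first.
  apply/forallP => j; apply/implyP => ji; rewrite -m'E // ltn_neqAle (mR j).2 ?setU11 // andbT.
  by rewrite (inj_eq (@r_inj j)) xi (inj_eq inj').
have [k hk] := dominantP _ dR (g i); have [e|ki] := eqVneq k i.
  by rewrite e in hk; apply: hk; exact: setU11.
by have := hk (m k); rewrite !inE (mS k).1 orbT leqNgt gMlt // => /(_ isT).
Qed.
End Dominant.

Section Scarf.
Variables (I T : finType) (r : I -> T -> nat) (c : T -> I) (t0 : T) (i0 : I).
Hypothesis r_inj : forall i, injective (r i).

Let E : finType := (T + I)%type.

(* Each order [i] receives a slack point [inr i] below all of [T]; the other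
   slack points are above all of [T]. *)
Let B := (\max_i \max_x r i x).+2.
Let slack_rank (i : I) (e : E) : nat :=
  match e with
  | inl x => (r i x).+1
  | inr j => if j == i then 0 else B + enum_rank j
  end.
Let color (e : E) : I := match e with inl x => c x | inr j => j end.

Let rank_lt_B i x : (r i x).+1 < B.
Proof.
rewrite ltnS ltnS (leq_trans (leq_bigmax x)) //.
exact: (leq_bigmax (F := fun i => \max_x r i x)).
Qed.

Let slack_rank_inj i : injective (slack_rank i).
Proof.
move=> [x|j] [y|k] /=.
- by case=> /r_inj ->.
- by case: eqP => // _ e; have := rank_lt_B i x; rewrite e ltnNge leq_addr.
- by case: eqP => // _ e; have := rank_lt_B i y; rewrite -e ltnNge leq_addr.
- case: eqP => [->|_]; case: eqP => [->|_] //.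
  by move=> /addnI /val_inj /enum_rank_inj ->.
Qed.

Let S0 : {set E} := inr @: (~: [set i0]).

Let color_S0 : color @: S0 = ~: [set i0].
Proof. by rewrite -imset_comp; apply: imset_id. Qed.

(** For [i != i0] the point [inr i] of [S0] is lowest in order [i], so only [i0] can witness
    dominance at points of [T]; the added point must be the [i0]-largest point of [T]. *)
Let outer_door_rooms :
  #|[set x | (x \notin S0) && dominant slack_rank (x |: S0)]| = 1.
Proof.
pose t := [arg max_(x > t0) r i0 x].
have tmax x : r i0 x <= r i0 t by rewrite /t; case: arg_maxnP => // y _; exact.
rewrite -(cards1 (inl t : E)); apply: eq_card => x; rewrite !inE.
have inlS0 y : (inl y : E) \notin S0 by apply/imsetP => -[].
have inrS0 j : ((inr j : E) \in S0) = (j != i0).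
  by rewrite mem_imset ?inE // => u v [].
apply/andP/eqP => [[xS dx]|->]; last first.
  split => //; apply/dominantP => -[y|j].
    exists i0 => -[z|j]; rewrite !inE ?inrS0 ?(negbTE (inlS0 _)) ?orbF /=.
      by move=> /eqP[->]; exact: tmax.
    by move=> /negbTE ->; rewrite ltnW // (leq_trans (rank_lt_B _ _)) // leq_addr.
  by exists j => z _ /=; rewrite eqxx.
have low y : exists2 z, x = inl z & r i0 y <= r i0 z.
  have [i hi] := dominantP _ _ dx (inl y); have [e|ii0] := eqVneq i i0; last first.
    by have := hi (inr i); rewrite !inE inrS0 ii0 orbT /= eqxx => /(_ isT).
  case: x xS dx hi => [z|j] xS _ /(_ _ (setU11 _ _)).
    by rewrite e => h; exists z.
  by move: xS; rewrite inrS0 negbK e => /eqP -> /=; rewrite eqxx.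
have [z xz _] := low t; have [z' e h] := low t; rewrite e; congr inl.
by apply: (@r_inj i0); apply/eqP; rewrite eqn_leq h tmax.
Qed.

(** The slack point [inr i] is the point required by [door_rooms], unless some minimum [m j] is a
    slack point other than [inr j]. Then [S] consists of all slack points but [inr j], and its
    colours force [j = i0], that is [S = S0]. *)
Let inner_door_rooms (S : {set E}) :
    color @: S = ~: [set i0] -> #|I| = #|S|.+1 -> S != S0 ->
  ~~ odd #|[set x | (x \notin S) && dominant slack_rank (x |: S)]|.
Proof.
move=> cS cI SS0.
have [dS|ndS] := boolP (dominant slack_rank S); last first.
  rewrite (_ : [set x | _] = set0) ?cards0 //; apply/setP => x; rewrite !inE.
  by apply: contraNF ndS => /andP[_]; apply: dominantS; exact: subsetUr.
have [m mS] : exists m, min_at slack_rank S m.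
  apply: min_at_exists; apply: contraNneq SS0 => e; rewrite e imset0 in cS.
  by rewrite e /S0 -cS imset0.
rewrite (door_rooms slack_rank_inj mS dS cI) // => i; exists (inr i) => j ji /=.
rewrite eq_sym (negbTE ji); have [mjS mjmin] := mS j.
case e: (m j) => [x|l] /=; first by rewrite (leq_trans (rank_lt_B _ _)) // leq_addr.
case: eqP => // /eqP lj; exfalso; move/eqP: SS0; apply.
have SE : S = inr @: (~: [set j]).
  apply/eqP; rewrite eqEcard; apply/andP; split; last first.
    rewrite card_imset; last by move=> u v [].
    by rewrite -ltnS -cI cardsC1 prednK //; apply/card_gt0P; exists i0.
  apply/subsetP => y /mjmin; rewrite e /= (negbTE lj); case: y => [y|k] /= h.
    by have := leq_trans (rank_lt_B j y) (leq_trans (leq_addr _ _) h); rewrite ltnn.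
  by rewrite imset_f // !inE; apply: contraL h => /eqP ->; rewrite eqxx.
have : [set i0] = [set j].
  apply: setC_inj; rewrite -cS SE -imset_comp; exact: imset_id.
by move=> /set1_inj ji0; rewrite SE -ji0.
Qed.

(** If a door exists while a colour is missing, [R] carries exactly the colours other than [i0], one
    of them twice; the doors arise by dropping either point of that colour. *)
Let room_doors (R : {set E}) : #|R| = #|I| -> color @: R != setT ->
  ~~ odd #|[set x in R | color @: (R :\ x) == ~: [set i0]]|.
Proof.
move=> cR ncol.
have [->|/set0Pn[x]] := eqVneq [set x in R | color @: (R :\ x) == ~: [set i0]] set0.
  by rewrite cards0.
rewrite inE => /andP[xR /eqP cx].
have colR : color @: R = ~: [set i0].
  have := ncol; rewrite -(setD1K xR) imsetU1 cx.
  have [e|xi0 _] := eqVneq (color x) i0; first by rewrite e setUCr eqxx.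
  by apply/setUidPr; rewrite sub1set !inE.
rewrite (_ : [set x in R | _] = [set x in R | color x \in color @: (R :\ x)]).
  rewrite card_collisions // colR cR cardsC1 prednK //.
  by apply/card_gt0P; exists i0.
apply/setP => y; rewrite !inE; case yR: (y \in R) => //=.
have colRy : color y |: color @: (R :\ y) = ~: [set i0].
  by rewrite -imsetU1 setD1K.
apply/eqP/idP => [e|]; last by rewrite -sub1set => /setUidPr e; rewrite -e.
by rewrite e -colR imset_f.
Qed.

(** Incidences of doors and rooms are counted in two ways. Only [S0] lies in an odd number of rooms,
    so some room has an odd number of doors; by [room_doors] it carries all colours. *)
Lemma scarf_room : exists R : {set E},
  [/\ #|R| = #|I|, dominant slack_rank R & color @: R = setT].
Proof.
pose door (S : {set E}) := (color @: S == ~: [set i0]) && (#|I| == #|S|.+1).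
pose room (R : {set E}) := (#|R| == #|I|) && dominant slack_rank R.
have dbl : \sum_(S | door S) #|[set x | (x \notin S) && dominant slack_rank (x |: S)]| =
    \sum_(R | room R) #|[set x in R | color @: (R :\ x) == ~: [set i0]]|.
  under eq_bigr do rewrite -sum1dep_card.
  under [RHS]eq_bigr do rewrite -sum1dep_card.
  rewrite (exchange_big_dep predT) // [RHS](exchange_big_dep predT) //=.
  apply: eq_bigr => x _.
  rewrite (reindex_onto (fun R => R :\ x) (fun S => x |: S)); last first.
    by move=> S /andP[_ /andP[xS _]]; rewrite setU1K.
  apply: eq_bigl => R; rewrite /door /room !inE eqxx /=.
  have [xR|xR] := boolP (x \in R); last first.
    rewrite andbF; apply/negbTE/negP => /andP[_ /eqP e].
    by rewrite -e setU11 in xR.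
  have := cardsD1 x R; rewrite xR setD1K // eqxx andbT => ->.
  by rewrite add1n [#|I| == _]eq_sym /= -!andbA andbCA; congr (_ && _); rewrite andbC.
have oddsum (F : {set E} -> nat) (P : pred {set E}) :
    odd (\sum_(S | P S) F S) = \big[addb/false]_(S | P S) odd (F S).
  exact: (big_morph odd oddD).
have dS0 : door S0.
  rewrite /door color_S0 eqxx card_imset; last by move=> u v [].
  by rewrite cardsC1 prednK ?eqxx //; apply/card_gt0P; exists i0.
have : odd (\sum_(S | door S) #|[set x | (x \notin S) && dominant slack_rank (x |: S)]|).
  rewrite oddsum (bigD1 S0) //= outer_door_rooms big1 // => S /andP[/andP[/eqP cS /eqP kS] SS0].
  exact/negbTE/inner_door_rooms.
rewrite dbl oddsum => oddR.
have [/existsP[R /andP[/andP[/eqP kR dR] /eqP cR]]|] :=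
  boolP [exists R, room R && (color @: R == setT)]; first by exists R.
rewrite negb_exists => /forallP none; move: oddR; rewrite big1 // => R rR.
apply/negbTE/room_doors; first by case/andP: rR => /eqP.
by have := none R; rewrite rR.
Qed.

(* [C] is the set of orders whose slack point is not in the room. *)
Theorem scarf : exists (S : {set T}) (C : {set I}),
  (forall x, exists2 i, i \in C & forall y, y \in S -> r i x <= r i y) /\
  (forall i, i \in C -> exists2 y, y \in S & c y = i).
Proof.
have [R [_ /dominantP dR cR]] := scarf_room.
exists [set x | inl x \in R], [set i | inr i \notin R]; split => [x|i].
  have [i hi] := dR (inl x); exists i.
    by rewrite inE; apply/negP => /hi /=; rewrite eqxx.
  by move=> y; rewrite inE => /hi.
rewrite inE => iR; have : i \in color @: R by rewrite cR.
case/imsetP => -[y|j] yR /= e; first by exists y; rewrite ?inE.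
by rewrite e yR in iR.
Qed.
End Scarf.

(* Scarf's theorem on the grid points of a simplex, ordered by their coordinates
   (ties broken arbitrarily): the points of a colourful room are close together
   and close to the faces opposite to the missing colours. *)
Lemma simplex_grid_coloring d k (c : ('I_d.+1 -> nat) -> 'I_d.+1) :
  exists2 z : 'I_d.+1 -> nat, \sum_i z i = k &
    forall i, z i <= d \/
      exists y, [/\ \sum_j y j = k, c y = i &
        forall j, y j <= z j + d /\ z j <= y j + d].
Proof.
pose T : finType := {y : {ffun 'I_d.+1 -> 'I_k.+1} | \sum_i (y i : nat) == k}.
pose v (y : T) (i : 'I_d.+1) : nat := val y i.
have sumv y : \sum_i v y i = k by apply/eqP; exact: (valP y).
have grid (x : 'I_d.+1 -> nat) : \sum_i x i = k -> exists t : T, v t =1 x.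
  move=> xk; have xlt i : x i < k.+1 by rewrite ltnS -xk (bigD1 i) //= leq_addr.
  have xP : \sum_i ([ffun i => Ordinal (xlt i)] : {ffun 'I_d.+1 -> 'I_k.+1}) i == k :> nat.
    by under eq_bigr do rewrite ffunE; rewrite /= xk.
  by exists (exist _ [ffun i => Ordinal (xlt i)] xP) => i; rewrite /v /= ffunE.
have [t0 _] : exists t : T, v t =1 (fun i => if i == ord0 then k else 0).
  by apply: grid; rewrite -big_mkcond big_pred1_eq.
(* The coordinate is the leading digit in base [#|T|]; the enumeration rank breaks ties. *)
pose r (i : 'I_d.+1) (y : T) := v y i * #|T| + enum_rank y.
have r_inj i : injective (r i).
  move=> x y e; apply/enum_rank_inj/val_inj.
  have := congr1 (modn^~ #|T|) e; rewrite /r /= !modnMDl !modn_small //.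
have r_le i x y : r i x <= r i y -> v x i <= v y i.
  apply: contraTT; rewrite -!ltnNge /r => h.
  apply: (@leq_trans ((v y i).+1 * #|T|)); first by rewrite mulSn addnC ltn_add2r.
  by rewrite (leq_trans _ (leq_addr _ _)) // leq_mul2r h orbT.
have [S [C [dom col]]] := @scarf _ _ r (c \o v) t0 ord0 r_inj.
have [i0 i0C _] := dom t0.
have [z zS _] := col _ i0C.
pose m (i : 'I_d.+1) := v [arg min_(y < z in S) v y i] i.
have m_le y i : y \in S -> m i <= v y i.
  by move=> yS; rewrite /m; case: arg_minnP => // x _; exact.
have m_in i : exists2 y, y \in S & m i = v y i.
  by rewrite /m; case: arg_minnP => // x xS _; exists x.
(* Otherwise the grid point with coordinates [m i + 1] on [C], the remaining mass being put on [i0],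
   would exceed the minimum of [S] in every order of [C], against dominance. *)
have sum_m : k < \sum_(i in C) (m i).+1.
  rewrite ltnNge; apply/negP => sk.
  pose x0 i := (if i \in C then (m i).+1 else 0) +
    (if i == i0 then k - \sum_(i in C) (m i).+1 else 0).
  have x0s : \sum_i x0 i = k.
    by rewrite /x0 big_split /= -!big_mkcond /= big_pred1_eq subnKC.
  have [x vx] := grid _ x0s; have [i iC hi] := dom x.
  have [y yS mi] := m_in i.
  have := r_le _ _ _ (hi y yS); rewrite -mi vx /x0 iC.
  by rewrite leqNgt ltnS leq_addr.
(* The left side is [k] minus the sum of [m] over [C], hence less than [#|C|] by [sum_m]. *)
have sumC y : y \in S -> \sum_(i in C) (v y i - m i) + \sum_(i | i \notin C) v y i <= d.
  move=> yS; have cC : #|C| <= d.+1 by rewrite -[leqRHS]card_ord max_card.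
  have : \sum_(i in C) (v y i - m i) + \sum_(i in C) (m i).+1
       = \sum_(i in C) v y i + #|C|.
    rewrite -sum1_card -!big_split /=; apply: eq_bigr => i iC.
    by have := m_le y i yS; lia.
  have := sumv y; rewrite (bigID (mem C)) /=; move: sum_m cC.
  move: (\sum_(i in C) (m i).+1) (\sum_(i in C) v y i) (\sum_(i in C) (v y i - m i)).
  move: (\sum_(i | i \notin C) v y i); move: #|C|; lia.
have near y i : y \in S -> i \in C -> v y i <= m i + d.
  move=> yS iC; have := sumC y yS; rewrite (bigD1 i) //= -addnA -leq_subLR.
  exact: leq_trans (leq_addr _ _).
have far y i : y \in S -> i \notin C -> v y i <= d.
  move=> yS iC; have := sumC y yS; rewrite addnC (bigD1 i) //= -addnA.
  exact: leq_trans (leq_addr _ _).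
exists (v z) => [|i]; first exact: sumv.
have [iC|/(far _ _ zS)] := boolP (i \in C); last by left.
have [y yS cy] := col i iC; right; exists (v y); split => // j.
have [jC|jC] := boolP (j \in C).
  have := near y j yS jC; have := near z j zS jC.
  have := m_le y j yS; have := m_le z j zS; lia.
have := far y j yS jC; have := far z j zS jC; lia.
Qed.

Require Import Defs.
From HB Require Import structures.
From mathcomp Require Import all_boot all_order all_algebra finmap ring lra.
From mathcomp Require Import all_classical all_reals all_analysis.
Import Order.TTheory GRing.Theory Num.Theory.
Import numFieldNormedType.Exports.
Local Open Scope classical_set_scope.
Local Open Scope ring_scope.

(** * Brouwer's fixed point theorem *)

Lemma ler_mx_norm (R : realDomainType) (m n : nat) (A : 'M[R]_(m, n)) (e : R) :
  0 <= e -> (forall i j, `|A i j| <= e) -> `|A| <= e.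
Proof. by move=> e0 h; rewrite [leLHS]/Num.Def.normr /= mx_normrE bigmax_le. Qed.

Lemma mx_norm_coord (R : realDomainType) (m n : nat) (A : 'M[R]_(m, n)) i j :
  `|A i j| <= `|A|.
Proof.
rewrite [leRHS]/Num.Def.normr /= mx_normrE.
exact: (@le_bigmax _ _ _ 0 (fun ij => `|A ij.1 ij.2|) (i, j)).
Qed.

Lemma continuous_sum (K : numFieldType) (V : normedModType K)
    (T : topologicalType) (I : Type) (r : seq I) (f : I -> T -> V) :
  (forall i, continuous (f i)) -> continuous (fun x => \sum_(i <- r) f i x).
Proof.
move=> cf; elim: r => [|i r IH] x.
  rewrite (_ : (fun _ => _) = fun=> 0); first exact: cvg_cst.
  by apply/funext => y; rewrite big_nil.
rewrite (_ : (fun _ => _) = fun y => f i y + \sum_(j <- r) f j y); last first.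
  by apply/funext => y; rewrite big_cons.
by apply: cvgD; [exact: cf|exact: IH].
Qed.

Lemma continuous_ge0 (R : realType) (V : normedModType R) (f : V -> R) (z : V) :
    {for z, continuous f} ->
    (forall e, 0 < e -> exists x, `|x - z| < e /\ - e <= f x) ->
  0 <= f z.
Proof.
move=> cf approx; rewrite leNgt; apply/negP => fz0.
have /nbhs_ballP[e /= e0 he] : nbhs z [set x | f x < f z / 2].
  by apply: (cvgr_lt _ cf); lra.
have [|x [xz fx]] := approx (Num.min e (- (f z / 2))).
  by rewrite lt_min e0 /=; lra.
have : f x < f z / 2.
  by apply: he; rewrite -ball_normE /= distrC (lt_le_trans xz) // ge_min lexx.
have : Num.min e (- (f z / 2)) <= - (f z / 2) by rewrite ge_min lexx orbT.
lra.
Qed.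

Section Brouwer.
Variables (R : realType) (d : nat) (f : 'rV[R]_d -> 'rV[R]_d) (K : R).
Hypotheses (K_gt0 : 0 < K) (f_bounded : forall x i, `|f x 0 i| <= K).

(** Side of the corner simplex given by [x_i >= - K] and [\sum_i (x_i + K) <= S], which contains the
    cube of the points with coordinates in [[- K, K]]. *)
Let S : R := 2 * K * d%:R.

(** Here [eta] is the length of [d] grid steps. A nearby point of each colour yields the inequality
    of that colour; failing such a point, [z] is within [d] steps of the opposite face, and the
    bound [K] on [f] yields the inequality at [z] itself. *)
Let brouwer_approx (k : nat) (eta := S * d%:R / k.+1%:R) :
  exists z : 'rV[R]_d, [/\
    forall i, - K <= z 0 i <= - K + S,
    forall i, exists2 x, `|x - z| <= eta & - eta <= f x 0 i - x 0 i &
    exists2 x, `|x - z| <= eta & - eta <= \sum_i (x 0 i - f x 0 i)].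
Proof.
have S0 : 0 <= S by rewrite !mulr_ge0 // ltW.
have eta0 : 0 <= eta by rewrite divr_ge0 // mulr_ge0.
pose p (y : 'I_d.+1 -> nat) : 'rV[R]_d :=
  \row_i (- K + S * (y (lift ord0 i))%:R / k.+1%:R).
(* Colour [ord0] belongs to the slack coordinate of the simplex. *)
pose c (y : 'I_d.+1 -> nat) : 'I_d.+1 :=
  if [pick i | p y 0 i <= f (p y) 0 i] is Some i then lift ord0 i else ord0.
have [z zk hz] := simplex_grid_coloring k.+1 c.
have dist y : (forall j, y j <= z j + d /\ z j <= y j + d)%N ->
    `|p y - p z| <= eta.
  move=> yz; apply: ler_mx_norm => // i j; rewrite !mxE.
  have [h1 h2] := yz (lift ord0 j).
  rewrite (_ : _ - _ = S / k.+1%:R *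
    ((y (lift ord0 j))%:R - (z (lift ord0 j))%:R)); last by ring.
  rewrite normrM ger0_norm; last by rewrite divr_ge0.
  rewrite /eta [leRHS]mulrAC ler_wpM2l ?divr_ge0 // ler_norml lerNl opprB lerBlDr -natrD.
  by rewrite lerBlDr addrC -!natrD !ler_nat; apply/andP; lia.
have sump y : (\sum_i y i = k.+1)%N ->
    \sum_i (p y) 0 i = K * d%:R - S * (y ord0)%:R / k.+1%:R.
  move=> yk; under eq_bigr do rewrite mxE.
  rewrite big_split /= sumr_const card_ord.
  have -> : \sum_(i < d) S * (y (lift ord0 i))%:R / k.+1%:R =
      S / k.+1%:R * (k.+1%:R - (y ord0)%:R).
    rewrite -yk big_ord_recl natrD addrAC subrr add0r natr_sum mulr_sumr.
    by apply: eq_bigr => i _; ring.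
  rewrite mulrBr divfK ?pnatr_eq0 // -mulr_natr /S; ring.
exists (p z); split.
- move=> i; rewrite mxE lerDl lerD2l ler_pdivrMr // ler_wpM2l // ?andbT.
    by rewrite divr_ge0 // mulr_ge0.
  by rewrite ler_nat -zk (bigD1 (lift ord0 i)) //= leq_addr.
- move=> i; have [zi|[y [yk cy yz]]] := hz (lift ord0 i).
    exists (p z); rewrite ?subrr ?normr0 //.
    have : p z 0 i <= - K + eta.
      rewrite mxE lerD2l /eta ler_wpM2r ?invr_ge0 // ler_wpM2l //.
      by rewrite ler_nat.
    have := f_bounded (p z) i; rewrite ler_norml => /andP[]; lra.
  exists (p y); first exact: dist.
  move: cy; rewrite /c; case: pickP => // j hj /lift_inj <-; lra.
- have [z0|[y [yk cy yz]]] := hz ord0.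
    exists (p z); rewrite ?subrr ?normr0 //.
    rewrite sumrB sump //.
    have : S * (z ord0)%:R / k.+1%:R <= eta.
      by rewrite ler_wpM2r ?invr_ge0 // ler_wpM2l // ler_nat.
    have : \sum_i f (p z) 0 i <= K * d%:R.
      have -> : K * d%:R = \sum_(i < d) K by rewrite sumr_const card_ord mulr_natr.
      by apply: ler_sum => i _; have := f_bounded (p z) i; rewrite ler_norml => /andP[].
    move: (\sum_i f (p z) 0 i) (S * _ / _) (K * _) => a b e; lra.
  exists (p y); first exact: dist.
  move: cy; rewrite /c; case: pickP => [j _ /eqP|none _].
    by rewrite eq_sym (negbTE (neq_lift _ _)).
  rewrite (le_trans (y := 0)) ?oppr_le0 // sumr_ge0 // => i _.
  by rewrite subr_ge0 ltW // ltNge none.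
Qed.

(** A cluster point [z] of the approximations satisfies [z <= f z] coordinatewise, while the
    coordinates of [f z - z] have sum at most 0; hence they all vanish. *)
Lemma brouwer_of_pos_bound : (forall i, continuous (fun x => f x 0 i)) ->
  exists x, f x = x.
Proof.
move=> cf.
have [Z hZ] := choice brouwer_approx.
have [z [_ cz]] : [set v : 'rV[R]_d | forall i, v ord0 i \in `[- K, - K + S]] `&`
    cluster (Z @ \oo) !=set0.
  apply: (@rV_compact R d (fun=> `[- K, - K + S]%classic)).
    by move=> i; exact: segment_compact.
  by exists 0%N => // k _ i; rewrite /= in_itv /=; case: (hZ k).
have close e : 0 < e ->
    exists k, `|Z k - z| < e / 2 /\ S * d%:R / k.+1%:R < e / 2.
  move=> e0.
  pose e' := e / 2 / (S * d%:R + 1).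
  have Sd0 : 0 <= S * d%:R by rewrite !mulr_ge0 // ltW.
  have e'0 : 0 < e' by rewrite !divr_gt0 // ltr_pwDr.
  have [N _ hN] : \forall k \near \oo, k.+1%:R^-1 < e' by exact: near_infty_natSinv_lt (PosNum e'0).
  have [] := cz [set Z k | k in [set k | (N <= k)%N]] (ball z (e / 2)).
  - by exists N => // k Nk; exists k.
  - by apply: nbhsx_ballx; rewrite divr_gt0.
  move=> _ [[k /hN hk <-]]; rewrite -ball_normE /= distrC => zk.
  exists k; split=> //; rewrite (le_lt_trans (y := S * d%:R * e')) ?ler_wpM2l // 1?ltW //.
  by rewrite /e' mulrCA gtr_pMr ?divr_gt0 // ltr_pdivrMr ?mul1r ?ltr_pwDr // ltrDl.
have fz i : 0 <= f z 0 i - z 0 i.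
  apply: (continuous_ge0 (f := fun x : 'rV[R]_d => f x 0 i - x 0 i)) => [|e e0].
    by apply: (@cvgB _ _ _ (nbhs z)); [exact: cf|exact: coord_continuous].
  have [k [zk ek]] := close e e0; have [_ /(_ i)[x xz fx] _] := hZ k.
  have ee : e / 2 < e by rewrite ltr_pdivrMr //; lra.
  exists x; split; last by rewrite (le_trans _ fx) // lerN2 ltW // (lt_trans ek).
  rewrite -(subrKA (Z k)) (le_lt_trans (ler_normD _ _)) // [ltRHS](splitr e).
  by rewrite ltrD // (le_lt_trans xz).
have fz' : 0 <= \sum_i (z 0 i - f z 0 i).
  apply: (continuous_ge0 (f := fun x : 'rV[R]_d => \sum_i (x 0 i - f x 0 i))) => [|e e0].
    apply: (@continuous_sum R R^o) => i x.
    by apply: (@cvgB _ _ _ (nbhs x)); [exact: coord_continuous|exact: cf].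
  have [k [zk ek]] := close e e0; have [_ _ [x xz fx]] := hZ k.
  have ee : e / 2 < e by rewrite ltr_pdivrMr //; lra.
  exists x; split; last by rewrite (le_trans _ fx) // lerN2 ltW // (lt_trans ek).
  rewrite -(subrKA (Z k)) (le_lt_trans (ler_normD _ _)) // [ltRHS](splitr e).
  by rewrite ltrD // (le_lt_trans xz).
have /eqP sum0 : \sum_i (f z 0 i - z 0 i) == 0.
  rewrite eq_le sumr_ge0 // andbT -oppr_ge0 -sumrN.
  by under eq_bigr do rewrite opprB.
exists z; apply/rowP => i; apply/eqP; rewrite -subr_eq0.
by rewrite (psumr_eq0P _ sum0).
Qed.
End Brouwer.

(* The coordinatewise bound replaces invariance of a cube: precomposing with a
   retraction reduces one form to the other. *)
Theorem brouwer (R : realType) (d : nat) (f : 'rV[R]_d -> 'rV[R]_d) (K : R) :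
    (forall x i, `|f x 0 i| <= K) ->
    (forall i, continuous (fun x => f x 0 i)) ->
  exists x, f x = x.
Proof.
move=> fK; apply: (@brouwer_of_pos_bound _ _ _ (`|K| + 1)).
  by rewrite ltr_pwDr.
by move=> x i; rewrite (le_trans (fK x i)) // (le_trans (ler_norm _)) // lerDl.
Qed.

Corollary brouwer_fintype (R : realType) (J : finType)
    (F : 'rV[R]_#|J| -> J -> R) (K : R) :
    (forall x j, `|F x j| <= K) -> (forall j, continuous (F^~ j)) ->
  exists x, forall j, F x j = x 0 (enum_rank j).
Proof.
move=> FK cF; have [||x fx] := @brouwer R #|J| (fun x => \row_i F x (enum_val i)) K.
- by move=> x i; rewrite mxE.
- by move=> i; under eq_fun do rewrite mxE; exact: cF.
by exists x => j; rewrite -{2}fx mxE enum_rankK.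
Qed.

(** * Approximate right inverses near a compact set of matrices *)

Lemma mx_norm_le_enorm (R : realType) (n : nat) (v : 'cV[R]_n) : `|v| <= enorm v.
Proof.
apply: ler_mx_norm => [|i j]; first exact: sqrtr_ge0.
rewrite ord1 -sqrtr_sqr ler_sqrt; last by apply: sumr_ge0 => k _; exact: sqr_ge0.
by rewrite (bigD1 i) //= lerDl sumr_ge0 // => k _; exact: sqr_ge0.
Qed.

Lemma enorm_le_mx_norm (R : realType) (n : nat) (v : 'cV[R]_n) :
  enorm v <= n%:R * `|v|.
Proof.
have nv0 : 0 <= n%:R * `|v| by rewrite mulr_ge0.
rewrite -(ger0_norm nv0) -sqrtr_sqr ler_sqrt; last exact: sqr_ge0.
apply: (@le_trans _ _ (\sum_(i < n) `|v| ^+ 2)).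
  apply: ler_sum => i _; rewrite -real_normK ?num_real // lerXn2r ?nnegrE //.
  exact: mx_norm_coord.
rewrite sumr_const card_ord -[leLHS]mulr_natl exprMn ler_wpM2r ?sqr_ge0 //.
by rewrite -natrX ler_nat; case: (n) => // m; rewrite leq_pmull.
Qed.

Lemma mulmx_norm (R : realType) (m n p : nat) (A : 'M[R]_(m, n)) (B : 'M[R]_(n, p)) :
  `|A *m B| <= n%:R * `|A| * `|B|.
Proof.
apply: ler_mx_norm => [|i j]; first by rewrite !mulr_ge0.
rewrite mxE (le_trans (ler_norm_sum _ _ _)) //.
apply: (@le_trans _ _ (\sum_(k < n) `|A| * `|B|)).
  by apply: ler_sum => k _; rewrite normrM ler_pM // mx_norm_coord.
by rewrite sumr_const card_ord -[leLHS]mulr_natl mulrA.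
Qed.

(** Each entry of [A] is a coordinate of the image of a unit basis vector. Boundedness comes first,
    because [sup] of an unbounded set is a default value. *)
Lemma mx_norm_le_opnorm (R : realType) (n N : nat) (A : 'M[R]_(n, N)) :
  `|A| <= opnorm A.
Proof.
pose S := [set enorm (A *m v) | v in [set v : 'cV[R]_N | enorm v <= 1]].
have enorm0 k : enorm (0 : 'cV[R]_k) = 0.
  by rewrite /enorm big1 ?sqrtr0 // => i _; rewrite mxE expr0n.
have hS : has_sup S.
  split; first by exists 0, 0; rewrite ?mulmx0 /= ?enorm0.
  exists (n%:R * (N%:R * `|A|)) => _ [v /= v1 <-].
  rewrite (le_trans (enorm_le_mx_norm _)) // ler_wpM2l //.
  rewrite (le_trans (mulmx_norm _ _)) // ler_piMr ?mulr_ge0 //.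
  exact: le_trans (mx_norm_le_enorm _) v1.
have SE : opnorm A = sup S by [].
apply: ler_mx_norm => [|i j].
  by rewrite SE; apply: ub_le_sup; [case: hS|exists 0; rewrite ?mulmx0 /= ?enorm0].
have Sj : S (enorm (A *m delta_mx j (0 : 'I_1))).
  exists (delta_mx j 0) => //=; rewrite /enorm (bigD1 j) //= big1 => [|k /negbTE kj].
    by rewrite mxE !eqxx expr1n addr0 sqrtr1.
  by rewrite mxE kj expr0n.
rewrite SE; apply: le_trans (ub_le_sup hS.2 Sj).
apply: le_trans (mx_norm_le_enorm _); apply: le_trans (mx_norm_coord _ i 0).
by rewrite -colE mxE.
Qed.

Lemma continuous_within_comp (X Y Z : topologicalType) (D : set Y) (f : Y -> Z)
    (p : X -> Y) :
    continuous p -> (forall x, D (p x)) -> {within D, continuous f} ->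
  continuous (f \o p).
Proof.
move=> cp Dp /subspace_continuousP cf x W /(cf (p x) (Dp x)) fW.
have {}fW : nbhs (p x) [set y | D y -> W (f y)] by exact: fW.
have : nbhs x [set z | D (p z) -> W (f (p z))] by exact: cp x _ fW.
by apply: filterS => y /=; apply; exact: Dp.
Qed.

Lemma continuous_maxr (R : realType) (T : topologicalType) (f g : T -> R) :
  continuous f -> continuous g -> continuous (fun x => Num.max (f x) (g x)).
Proof. by move=> cf cg x; exact: (@continuous_max R T f g x (cf x) (cg x)). Qed.

Lemma continuous_minr (R : realType) (T : topologicalType) (f g : T -> R) :
  continuous f -> continuous g -> continuous (fun x => Num.min (f x) (g x)).
Proof. by move=> cf cg x; exact: (@continuous_min R T f g x (cf x) (cg x)). Qed.

(** Tent functions on a finite subcover by balls of half radius are divided by [Num.max r (tot y)],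
    which is positive and continuous everywhere and equals [tot y] near [A]. *)
Lemma partition_of_unity_near_compact (R : realType) (m n : nat)
    (A : set 'M[R]_(m, n)) (rad : 'M[R]_(m, n) -> R) :
    compact A -> (forall x, 0 < rad x) ->
  exists (J : finType) (c : J -> 'M[R]_(m, n)) (theta : J -> 'M[R]_(m, n) -> R)
      (r : R),
  [/\ 0 < r /\ forall j, A (c j), forall j, continuous (theta j),
    forall j y, 0 <= theta j y,
    forall j y, theta j y != 0 -> `|y - c j| < rad (c j) &
    forall x y, A x -> `|y - x| < r -> \sum_j theta j y = 1].
Proof.
move=> cA rad0.
move: cA; rewrite compact_cover => /(_ _ A (fun x => ball x (rad x / 2))).
case=> [x _|x Ax|D DA Dcov].
- exact: ball_open.
- by exists x => //; apply: ballxx; rewrite divr_gt0.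
(* A point within [r] of [A] is within 3/4 of the radius from some centre, so its tent there is at
   least a quarter of the radius, hence at least [r]. The default 1 covers an empty family. *)
pose r := \big[Num.min/1]_(x : D) (rad (val x) / 4).
have r0 : 0 < r by apply: lt_bigmin => // x _; rewrite divr_gt0.
pose bump (x : D) (y : 'M[R]_(m, n)) := Num.max 0 (rad (val x) - `|y - val x|).
have bump0 x y : 0 <= bump x y by rewrite le_max lexx.
have cbump x : continuous (bump x).
  apply: (@continuous_maxr _ _ (fun=> 0)); first exact: cst_continuous.
  move=> y.
  apply: (@cvgB _ _ _ (nbhs y)); first exact: cvg_cst.
  by apply: cvg_norm; apply: cvgB; [exact: cvg_id|exact: cvg_cst].
pose tot y := \sum_(x : D) bump x y.
have den0 y : 0 < Num.max r (tot y) by rewrite lt_max r0.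
exists D, val, (fun x y => bump x y / Num.max r (tot y)), r; split => //.
- by split=> // x; have := DA _ (valP x); rewrite inE.
- have cden : continuous (fun y => Num.max r (tot y)).
    apply: (@continuous_maxr _ _ (fun=> r)); first exact: cst_continuous.
    by apply: (@continuous_sum R R^o) => z; exact: cbump.
  move=> x y; apply: (@cvgM _ _ (nbhs y)); first exact: cbump.
  by apply: cvgV; [rewrite gt_eqF|exact: cden].
- by move=> x y; rewrite divr_ge0 // ltW.
- move=> x y; apply: contraNT; rewrite -leNgt => h.
  by rewrite /bump max_l ?mul0r // subr_le0.
- move=> x y Ax yx; rewrite -mulr_suml.
suff tr : r <= tot y by rewrite max_r // divff // gt_eqF // (lt_le_trans r0).
have [z /= zD xz] := Dcov x Ax.
rewrite /tot (bigD1 [` zD]%fset) //= (le_trans (y := bump [` zD]%fset y)) //; last first.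
  by rewrite lerDl sumr_ge0.
have rz : r <= rad z / 4 by apply: (@bigmin_le_cond _ _ _ _ [` zD]%fset).
rewrite /bump le_max; apply/orP; right; rewrite lerBrDr.
move: xz; rewrite -ball_normE /= distrC => xz.
have := ler_normD (y - x) (x - z); rewrite subrKA.
have := rad0 z; lra.
Qed.

(** The sum of two elements is twice their midpoint. *)
Lemma convex_cone_sum (R : realType) (N : nat) (Gamma : set 'cV[R]_N) (I : finType)
    (a : I -> R) (g : I -> 'cV[R]_N) :
    cone Gamma -> convex_set (Gamma : set (convex_lmodType 'cV[R]_N)) ->
    Gamma 0 -> (forall i, 0 <= a i) -> (forall i, Gamma (g i)) ->
  Gamma (\sum_i a i *: g i).
Proof.
move=> coneG convG G0 a0 Gg; elim/big_ind: _ => // [u v Gu Gv|i _]; last exact: coneG.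
have half0 : 0 <= 2^-1 :> R by rewrite invr_ge0.
have half1 : 2^-1 <= 1 :> R by rewrite invf_le1 // ler1n.
have Guv : Gamma (2^-1 *: u + (1 - 2^-1) *: v).
  exact: (set_mem (convG u v (Itv01 half0 half1) (mem_set Gu) (mem_set Gv))).
have := coneG 2 _ (ler0n _ 2) Guv.
rewrite scalerDr !scalerA mulrBr mulr1 divff ?pnatr_eq0 //.
by rewrite (_ : 2 - 1 = 1 :> R) ?scale1r //; ring.
Qed.

Lemma maxr0_sign_sum (R : realType) (t : R) :
  Num.max 0 ((-1) ^+ true * t) + Num.max 0 ((-1) ^+ false * t) = `|t|.
Proof.
rewrite expr1 expr0 mulN1r mul1r.
by case: (lerP 0 t) => t0; rewrite ?(ger0_norm t0) ?(ltr0_norm t0); case: lerP; lra.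
Qed.

Lemma maxr0_sign_diff (R : realType) (t : R) :
  Num.max 0 ((-1) ^+ true * t) * (-1) ^+ true +
  Num.max 0 ((-1) ^+ false * t) * (-1) ^+ false = t.
Proof.
rewrite !expr1 !expr0 !mulN1r !mul1r mulrN1 mulr1.
by case: (lerP 0 t) => t0; case: lerP; lra.
Qed.

(** Preimages of the signed basis vectors under [L] remain approximate preimages under every [M] in
    a ball around [L]; the partition of unity is subordinate to such balls. *)
Lemma near_right_inverses (R : realType) (N n : nat) (Gamma : set 'cV[R]_N)
    (Lambda : set 'M[R]_(n, N)) (eps : R) :
    0 < eps -> compact Lambda ->
    (forall L, Lambda L -> [set L *m g | g in Gamma] = [set: 'cV[R]_n]) ->
  exists (J : finType) (g : J -> 'I_n -> bool -> 'cV[R]_N)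
      (theta : J -> 'M[R]_(n, N) -> R) (r : R),
  [/\ 0 < r, forall j i b, Gamma (g j i b), forall j, continuous (theta j),
    forall j M, 0 <= theta j M &
    (forall L M, Lambda L -> `|M - L| < r ->
      \sum_j theta j M = 1 /\
      forall j, theta j M != 0 -> forall i b,
        `|M *m g j i b - (-1) ^+ b *: delta_mx i 0| <= eps)].
Proof.
move=> eps0 cL surj.
have inv (L : 'M[R]_(n, N)) : exists gr : ('I_n -> bool -> 'cV[R]_N) * R,
    0 < gr.2 /\ (Lambda L -> forall i b, Gamma (gr.1 i b) /\
      forall M, `|M - L| < gr.2 ->
        `|M *m gr.1 i b - (-1) ^+ b *: delta_mx i 0| <= eps).
  (* Dummy values off [Lambda] give [choice] a total function with positive radii. *)
  have [LL|nL] := pselect (Lambda L); last by exists ((fun _ _ => 0), 1).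
  have hg (ib : 'I_n * bool) :
      exists v, Gamma v /\ L *m v = (-1) ^+ ib.2 *: delta_mx ib.1 0.
    have : [set: 'cV[R]_n] ((-1) ^+ ib.2 *: delta_mx ib.1 0) by [].
    by rewrite -(surj L LL) => -[v Gv Lv]; exists v.
  have [g gP] := choice hg.
  pose B := \sum_ib `|g ib| + 1.
  have B0 : 0 < B by rewrite ltr_pwDr // sumr_ge0.
  have gB ib : `|g ib| <= B.
    by rewrite /B (bigD1 ib) //= -addrA lerDl addr_ge0 // sumr_ge0.
  have N0 : 0 < N.+1%:R :> R by rewrite ltr0n.
  (* The radius comes from [mulmx_norm]; [N.+1] keeps the denominator positive. *)
  exists ((fun i b => g (i, b)), eps / (N.+1%:R * B)); split => /=.
    by rewrite divr_gt0 // mulr_gt0.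
  move=> _ i b; have [Gv Lv] := gP (i, b); split=> // M ML.
  rewrite -Lv -mulmxBl (le_trans (mulmx_norm _ _)) //.
  rewrite (le_trans (y := N.+1%:R * `|M - L| * B)) //.
    by rewrite ler_pM ?mulr_ge0 // ler_wpM2r // ler_nat.
  by rewrite mulrAC mulrC -ler_pdivlMr ?mulr_gt0 // ltW.
have [gr grP] := choice inv.
have [J [c [theta [r [[r0 cL'] ctheta theta0 supp one]]]]] :=
  partition_of_unity_near_compact cL (fun L => (grP L).1).
exists J, (fun j => (gr (c j)).1), theta, r; split => //.
  by move=> j i b; have [] := (grP (c j)).2 (cL' j) i b.
move=> L M LL ML; split; first exact: one LL ML.
by move=> j /supp Mj i b; have [_] := (grP (c j)).2 (cL' j) i b; apply.
Qed.

(** * The equation as a fixed point problem *)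

Section FixedPoint.
Variables (R : realType) (N n : nat) (Gamma : set 'cV[R]_N) (gbar : 'cV[R]_N).
Variables (J : finType) (g : J -> 'I_n -> bool -> 'cV[R]_N).
Variables (theta : J -> 'M[R]_(n, N) -> R).
Variables (L : 'cV[R]_N -> 'M[R]_(n, N)) (h : 'cV[R]_N -> 'cV[R]_n).
Variables (y : 'cV[R]_n) (s C : R).

Let idx : finType := (J * 'I_n * bool)%type.
Let G (p : idx) : 'cV[R]_N := g p.1.1 p.1.2 p.2.
Let D := translate gbar (cball (s * C) `&` Gamma).

Hypotheses (hn : (0 < n)%N) (s0 : 0 < s).
Hypothesis C_ge : N%:R * \sum_p `|G p| <= C.
Hypotheses (coneG : cone Gamma)
  (convG : convex_set (Gamma : set (convex_lmodType 'cV[R]_N))) (G0 : Gamma 0).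
Hypotheses (Gg : forall j i b, Gamma (g j i b))
  (ctheta : forall j, continuous (theta j)) (theta0 : forall j M, 0 <= theta j M).
Hypothesis cLh : {within D, continuous (fun x => (L x, h x))}.
Hypothesis theta1 : forall x, D x -> \sum_j theta j (L x) = 1.
Hypothesis Lg : forall x, D x -> forall j, theta j (L x) != 0 -> forall i b,
  `|L x *m g j i b - (-1) ^+ b *: delta_mx i 0| <= (2 * n%:R)^-1.
Hypotheses (h_small : forall x, D x -> `|h x| <= s / 4) (y_small : `|y| <= s / 4).

(** Clamping lets the fixed point map be defined and bounded on the whole space of unknowns, as
    [brouwer] demands, and keeps [V x] in the cone and in the ball. *)
Let clamp (a b t : R) : R := Num.max a (Num.min b t).

Let clamp_itv a b t : a <= b -> a <= clamp a b t <= b.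
Proof. by move=> ab; rewrite /clamp le_max lexx ge_max ab ge_min lexx. Qed.

Let clamp_id a b t : a <= t <= b -> clamp a b t = t.
Proof. by case/andP => at_ tb; rewrite /clamp min_r // max_r. Qed.

Let continuous_clamp (T : topologicalType) a b (f : T -> R) :
  continuous f -> continuous (fun x => clamp a b (f x)).
Proof.
move=> cf; apply: (@continuous_maxr _ _ (fun=> a)); first exact: cst_continuous.
by apply: (@continuous_minr _ _ (fun=> b)); first exact: cst_continuous.
Qed.

Let X := 'rV[R]_#|{: idx + 'I_n}|.

(* The unknowns are the coefficients of a point [gbar + V x] of the cone along
   the vectors [G p], together with the target vector [ww x] in R^n. *)
Let cc (x : X) (p : idx) : R := clamp 0 s (x 0 (enum_rank (inl p))).
Let ww (x : X) (i : 'I_n) : R := clamp (- s) s (x 0 (enum_rank (inr i))).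
Let V (x : X) : 'cV[R]_N := \sum_p cc x p *: G p.
Let M (x : X) := L (gbar + V x).
Let q (x : X) (p : idx) : R :=
  theta p.1.1 (M x) * Num.max 0 ((-1) ^+ p.2 * ww x p.1.2).
Let W (x : X) : 'cV[R]_N := \sum_p q x p *: G p.
(** At a fixed point the first block gives [V x = W x], and the second then reads
    [M x *m V x + h (gbar + V x) = y]. *)
Let F (x : X) (k : idx + 'I_n) : R :=
  match k with
  | inl p => q x p
  | inr i => ww x i - ((M x *m W x) i 0 + h (gbar + V x) i 0 - y i 0)
  end.

Let cc_itv x p : 0 <= cc x p <= s.
Proof. by apply: clamp_itv; exact: ltW. Qed.

Let ww_norm x i : `|ww x i| <= s.
Proof. by rewrite ler_norml clamp_itv // ge0_cp // ltW. Qed.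

Let Gamma_V x : Gamma (V x).
Proof.
apply: convex_cone_sum => // [p|p]; last exact: Gg.
by case/andP: (cc_itv x p).
Qed.

Let enorm_V x : enorm (V x) <= s * C.
Proof.
rewrite (le_trans (enorm_le_mx_norm _)) //.
rewrite (le_trans (y := s * (N%:R * \sum_p `|G p|))) //; last by rewrite ler_wpM2l // ltW.
rewrite mulrCA ler_wpM2l //.
rewrite (le_trans (ler_norm_sum _ _ _)) // mulr_sumr ler_sum // => p _.
have /andP[c0 c1] := cc_itv x p.
by rewrite normrZ ger0_norm // ler_wpM2r.
Qed.

Let DV x : D (gbar + V x).
Proof. by exists (V x); [split; [exact: enorm_V|exact: Gamma_V]|]. Qed.

Let q_itv x p : 0 <= q x p <= s.
Proof.
have m0 : 0 <= Num.max 0 ((-1) ^+ p.2 * ww x p.1.2) by rewrite le_max lexx.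
have t1 : theta p.1.1 (M x) <= 1.
  by rewrite -(theta1 (DV x)) (bigD1 p.1.1) //= lerDl sumr_ge0.
rewrite mulr_ge0 //= (le_trans (ler_piMl m0 t1)) // ge_max (ltW s0) /=.
by rewrite (le_trans (ler_norm _)) // normrM normrX normrN1 expr1n mul1r ww_norm.
Qed.

Let sum_idx (U : nmodType) (f : idx -> U) :
  \sum_p f p = \sum_j \sum_i (f (j, i, true) + f (j, i, false)).
Proof.
rewrite pair_bigA /= (eq_bigr (fun p => \sum_b f (p, b))).
  by rewrite pair_bigA /=; apply: eq_bigr => -[].
by move=> [j i] _; rewrite big_bool.
Qed.

(** As the [theta] sum to 1, [ww x] is the combination of the signed basis vectors [e p] with the
    coefficients [q x p] of [W x]. Wherever [q x p] is nonzero, [M x *m G p] is within 1/(2n) of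
    [e p], and the [q x p] add up to the l1 norm of [ww x], at most [n s]. *)
Let MW_close x i : `|ww x i - (M x *m W x) i 0| <= s / 2.
Proof.
pose w : 'cV[R]_n := \col_i ww x i.
pose e (p : idx) : 'cV[R]_n := (-1) ^+ p.2 *: delta_mx p.1.2 0.
have we : w = \sum_p q x p *: e p.
  rewrite sum_idx.
  under eq_bigr => j _. 
    under eq_bigr => k _.
      rewrite /q /e /= !scalerA -scalerDl -!mulrA -mulrDr maxr0_sign_diff -scalerA.
      over.
    rewrite -scaler_sumr. over.
  rewrite -scaler_suml theta1 // scale1r.
  apply/colP => k; rewrite summxE mxE (bigD1 k) //= big1 => [|l lk].
    by rewrite !mxE !eqxx mulr1 addr0.
  by rewrite !mxE eq_sym (negbTE lk) mulr0.
have -> : ww x i = w i 0 by rewrite mxE.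
have -> : w i 0 - (M x *m W x) i 0 = (w - M x *m W x) i 0 by rewrite !mxE.
rewrite (le_trans (mx_norm_coord _ _ _)) // distrC we /W mulmx_sumr -sumrB.
rewrite (le_trans (ler_norm_sum _ _ _)) //.
apply: (@le_trans _ _ (\sum_p q x p * (2 * n%:R)^-1)).
  apply: ler_sum => p _; rewrite -scalemxAr -scalerBr normrZ.
  have /andP[q0 _] := q_itv x p; rewrite (ger0_norm q0).
  have [t0|t0] := eqVneq (theta p.1.1 (M x)) 0; first by rewrite /q t0 !mul0r.
  by rewrite ler_wpM2l //; apply: Lg.
rewrite -mulr_suml sum_idx.
under eq_bigr => j _.
  under eq_bigr => k _ do rewrite /q /= -mulrDr maxr0_sign_sum.
  rewrite -mulr_sumr. over.
rewrite -mulr_suml theta1 // mul1r invfM mulrA mulrAC ler_wpM2r ?invr_ge0 //.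
rewrite ler_pdivrMr ?ltr0n // (le_trans (ler_sum _ (fun k _ => ww_norm x k))) //.
by rewrite sumr_const card_ord mulr_natr.
Qed.

(** In the second block, s/2 comes from [MW_close] and s/4 from each of [h] and [y]. *)
Let F_bounded x k : `|F x k| <= s.
Proof.
case: k => [p|i] /=; first by have /andP[q0 qs] := q_itv x p; rewrite ger0_norm.
have := MW_close x i.
have := le_trans (mx_norm_coord _ i 0) (h_small (DV x)).
have := le_trans (mx_norm_coord _ i 0) y_small.
rewrite !ler_norml => /andP[a1 a2] /andP[b1 b2] /andP[c1 c2].
by apply/andP; lra.
Qed.

Let cV_ : continuous V.
Proof.
apply: continuous_sum => p x; apply: (@cvgZ _ _ _ (nbhs x)).
  by apply: continuous_clamp => z; exact: coord_continuous.
exact: cvg_cst.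
Qed.

Let cLh_V : continuous (fun x => (M x, h (gbar + V x))).
Proof.
apply: (continuous_within_comp (p := fun x => gbar + V x) _ DV cLh) => x.
by apply: (@cvgD _ _ _ (nbhs x)); [exact: cvg_cst|exact: cV_].
Qed.

Let cM : continuous M.
Proof.
have cfst : continuous (@fst 'M[R]_(n, N) 'cV[R]_n) by move=> p; exact: cvg_fst.
by move=> x; exact: (cvg_comp _ fst (@cLh_V x) (cfst _)).
Qed.

Let ch : continuous (fun x => h (gbar + V x)).
Proof.
have csnd : continuous (@snd 'M[R]_(n, N) 'cV[R]_n) by move=> p; exact: cvg_snd.
by move=> x; exact: (cvg_comp _ snd (@cLh_V x) (csnd _)).
Qed.

Let cww i : continuous (ww^~ i).
Proof. by apply: continuous_clamp => z; exact: coord_continuous. Qed.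

Let cq p : continuous (q^~ p).
Proof.
have cmax : continuous (fun x => Num.max 0 ((-1) ^+ p.2 * ww x p.1.2)).
  apply: (@continuous_maxr _ _ (fun=> 0)) => [|z]; first exact: cst_continuous.
  by apply: (@cvgM _ _ (nbhs z)); [exact: cvg_cst|exact: cww].
move=> x; apply: (@cvgM _ _ (nbhs x)); last exact: cmax.
exact: (cvg_comp _ (theta p.1.1) (@cM x) (@ctheta p.1.1 _)).
Qed.

Let cW : continuous W.
Proof.
by apply: continuous_sum => p x; apply: (@cvgZ _ _ _ (nbhs x)); [exact: cq|exact: cvg_cst].
Qed.

Let cF k : continuous (F^~ k).
Proof.
case: k => [p|i]; first exact: cq.
move=> x; apply: (@cvgB _ _ _ (nbhs x)); first exact: cww.
apply: (@cvgB _ _ _ (nbhs x)); last exact: cvg_cst.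
apply: (@cvgD _ _ _ (nbhs x)); last first.
  by apply: (cvg_comp _ (fun A : 'cV[R]_n => A i 0) (@ch x)); exact: coord_continuous.
have -> : (fun z => (M z *m W z) i 0) = (fun z => \sum_k M z i k * W z k 0).
  by apply/funext => z; rewrite mxE.
rewrite mxE.
apply: (@continuous_sum R R^o) => k z; apply: (@cvgM _ _ (nbhs z)).
  by apply: (cvg_comp _ (fun A : 'M[R]_(n, N) => A i k) (@cM z)); exact: coord_continuous.
by apply: (cvg_comp _ (fun A : 'cV[R]_N => A k 0) (@cW z)); exact: coord_continuous.
Qed.

Lemma near_right_inverse_solvable :
  exists v, [/\ Gamma v, enorm v <= s * C & L (gbar + v) *m v + h (gbar + v) = y].
Proof.
have [x Fx] := brouwer_fintype F_bounded cF.
exists (V x); split; [exact: Gamma_V|exact: enorm_V|].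
(* The raw unknowns equal [q x p], which lies in [[0, s]], so clamping leaves them fixed. *)
have VW : V x = W x.
  apply: eq_bigr => p _; congr (_ *: _).
  by rewrite /cc -(Fx (inl p)) /= clamp_id // q_itv.
apply/colP => i; have : ww x i = F x (inr i).
  rewrite /ww -(Fx (inr i)) clamp_id // -ler_norml.
  exact: F_bounded.
rewrite /F -/(M x) -VW => e; rewrite mxE; apply/eqP.
by rewrite -subr_eq0; apply/eqP; lra.
Qed.
End FixedPoint.

(** * The open mapping estimate and its consequences *)

(** The fixed point problem is used with [s = delta / C]. Smallness of [rho delta] serves twice:
    below [r] it puts the values of [L] near [Lambda], below 1/(4C) it bounds [h] by
    [delta / (4 * C)], which is s/4. *)
Lemma qdq_open_mapping (R : realType) (N n : nat) (hn : (0 < n)%N)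
    (Gamma : set 'cV[R]_N) (F : 'cV[R]_N -> set 'cV[R]_n)
    (gbar : 'cV[R]_N) (ybar : 'cV[R]_n)
    (Lambda : set 'M[R]_(n, N)) (rho : R -> R) :
    cone Gamma -> convex_set (Gamma : set (convex_lmodType 'cV[R]_N)) ->
    compact Lambda -> Lambda !=set0 -> modulus rho ->
    (forall L, Lambda L -> [set L *m g | g in Gamma] = [set: 'cV[R]_n]) ->
  exists delta0 C : R, [/\ 0 < delta0, 0 < C &
    forall delta, 0 < delta -> delta <= delta0 ->
    forall L h, qdq_map F gbar ybar Lambda Gamma rho delta L h ->
    forall y, enorm y <= delta / (4 * C) ->
    exists v, [/\ Gamma v, enorm v <= delta &
      L (gbar + v) *m v + h (gbar + v) = y]].
Proof.
move=> coneG convG cL [L0 LL0] [_ _ _ rho_lim] surj.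
have G0 : Gamma 0.
  have : [set: 'cV[R]_n] 0 by [].
  rewrite -(surj L0 LL0) => -[v Gv _].
  by rewrite -(scale0r v); exact: coneG.
have eps0 : 0 < (2 * n%:R)^-1 :> R by rewrite invr_gt0 mulr_gt0 // ltr0n.
have [J [g [theta [r [r0 Gg ctheta theta0 near]]]]] :=
  near_right_inverses eps0 cL surj.
pose C : R := N%:R * \sum_(p : J * 'I_n * bool) `|g p.1.1 p.1.2 p.2| + 1.
have C0 : 0 < C by rewrite ltr_pwDr // mulr_ge0 // sumr_ge0.
have [d d0 rho_d] : exists2 d, 0 < d & forall t, 0 < t -> t < d ->
    rho t < Num.min r (4 * C)^-1.
  have m0 : 0 < Num.min r (4 * C)^-1 by rewrite lt_min r0 invr_gt0 mulr_gt0.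
  have [d /= d0 hd] := cvgr_lt _ rho_lim _ m0; exists d => // t t0 td.
  by apply: hd => //=; rewrite sub0r normrN gtr0_norm.
exists (d / 2), C; split=> // [|delta del0 deld L h [cLh qdq] y ysmall].
  by rewrite divr_gt0.
have := rho_d delta del0; rewrite lt_min => /(_ _)/andP[|rho_r rho_C].
  by rewrite (le_lt_trans deld) // ltr_pdivrMr // ltr_pMr // ltr1n.
have s0 : 0 < delta / C by rewrite divr_gt0.
have sC : delta / C * C = delta by rewrite divfK // gt_eqF.
have s4 : delta / C / 4 = delta / (4 * C) by rewrite -mulrA -invfM mulrC [C * 4]mulrC mulrC.
have nearL x : translate gbar (cball delta `&` Gamma) x ->
    exists2 L', Lambda L' & `|L x - L'| < r.
  move=> /qdq[[m [[L' LL' <-] _] mrho] _ _]; exists L' => //.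
  by rewrite (le_lt_trans (mx_norm_le_opnorm _)) // (le_lt_trans mrho).
rewrite -{}sC in cLh qdq nearL *.
apply: (near_right_inverse_solvable (theta := theta) (g := g)) => //.
- by rewrite lerDl.
- by move=> x /nearL[L' LL' xL']; case: (near _ _ LL' xL').
- by move=> x /nearL[L' LL' xL']; case: (near _ _ LL' xL').
- move=> x /qdq[_ hx _]; rewrite (le_trans (mx_norm_le_enorm _)) // (le_trans hx) //.
  rewrite s4 divfK ?gt_eqF // ler_wpM2l // ltW //.
- by rewrite s4 (le_trans (mx_norm_le_enorm _)).
Qed.

Theorem theorem2p2 (R : realType) (N n : nat) (hN : (0 < N)%N) (hn : (0 < n)%N)
    (Gamma : set 'cV[R]_N)
    (Gamma_cone : cone Gamma)
    (Gamma_convex : convex_set (Gamma : set (convex_lmodType 'cV[R]_N)))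
    (F : 'cV[R]_N -> set 'cV[R]_n)
    (gbar : 'cV[R]_N) (ybar : 'cV[R]_n)
    (Lambda : set 'M[R]_(n, N)) (rho : R -> R)
    (Lambda_QDQ : is_QDQ_with F gbar ybar Lambda Gamma rho)
    (Lambda_surj : forall L, Lambda L ->
       [set L *m g | g in Gamma] = [set: 'cV[R]_n]) :
  exists alpha beta : R,
  [/\ 0 < alpha, 0 < beta,
      (forall a : R, 0 < a -> a <= alpha ->
         translate ybar (cball a `\ 0)
           `<=` svimage F (translate gbar (cball (a * beta) `&` Gamma))),
      (exists2 delta0 : R, 0 < delta0 &
         forall delta : R, 0 < delta -> delta <= delta0 ->
         forall (L : 'cV[R]_N -> 'M[R]_(n, N)) (h : 'cV[R]_N -> 'cV[R]_n),
         qdq_map F gbar ybar Lambda Gamma rho delta L h ->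
         exists g : 'cV[R]_N,
           [/\ translate gbar (Gamma `&` cball delta) g,
               ybar = ybar + L g *m (g - gbar) + h g
             & F g (ybar + L g *m (g - gbar) + h g)])
    & (exists alpha' : R,
         [/\ 0 < alpha', alpha' <= alpha &
           forall a : R, 0 < a -> a <= alpha' ->
           translate ybar (cball a)
             `<=` svimage F (translate gbar (cball (a * beta) `&` Gamma))])].
Proof.
have [cL L0 mrho qdq] := Lambda_QDQ.
have [delta0 [C [d0 C0 open]]] :=
  qdq_open_mapping hn F gbar ybar Gamma_cone Gamma_convex cL L0 mrho Lambda_surj.
have shift v : gbar + v - gbar = v by rewrite addrAC subrr add0r.
have C40 : 0 < 4 * C by rewrite mulr_gt0.
(* The radius [delta = a * (4 * C)] turns the condition on [y] into [enorm y <= a]. *)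
have ball a : 0 < a -> a <= delta0 / (4 * C) -> translate ybar (cball a)
    `<=` svimage F (translate gbar (cball (a * (4 * C)) `&` Gamma)).
  move=> a0 ad _ [y ya <-]; have del0 : 0 < a * (4 * C) by rewrite mulr_gt0.
  have [L [h Lh]] := qdq _ del0.
  have [||v [Gv vd Ly]] := open _ del0 _ L h Lh y.
  - by rewrite -ler_pdivlMr.
  - by rewrite mulfK // gt_eqF.
  have Dv : translate gbar (cball (a * (4 * C)) `&` Gamma) (gbar + v) by exists v.
  exists (gbar + v) => //; have [_ _] := Lh.2 _ Dv.
  by rewrite shift -addrA Ly.
exists (delta0 / (4 * C)), (4 * C); split => //.
- by rewrite divr_gt0.
- move=> a a0 ad _ [y [ya _] <-]; apply: (ball a a0 ad); by exists y.
(* Part (ii) is the case [y = 0] of the estimate. *)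
- exists delta0 => // delta del0 deld L h Lh.
  have [|v [Gv vd Ly]] := open _ del0 deld L h Lh 0.
    by rewrite /enorm big1 ?sqrtr0 ?divr_ge0 ?ltW // => i _; rewrite mxE expr0n.
  have Dv : translate gbar (cball delta `&` Gamma) (gbar + v) by exists v.
  exists (gbar + v); split; first by exists v.
    by rewrite shift -addrA Ly addr0.
  by have [] := Lh.2 _ Dv.
- by exists (delta0 / (4 * C)); split => //; rewrite divr_gt0.
Qed.
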